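(* Let $\aleph$ be an arbitrary uncountable cardinal. There exist a compact, totally disconnected linearly ordered topological space $X$ such that every nonempty open subset of $X$ has cardinality at least $\aleph$, and a balanced topological tournament $R$ on $X$, such that: the set of cycle points for $R$ is a dense $G_\delta$ subset of $X$; the set of points $x\in X$ for which $\{x\}$ is not a $G_\delta$ set is also a dense subset of $X$; and no nonempty open subset of $X$ is separable.
   Context: All spaces are Hausdorff. A linearly ordered topological space is a linearly ordered set equipped with its order topology. A tournament on a nonempty set $X$ is a relation $R\subset X\times X$ with $R\cap R^{-1}=1_X=\{(x,x):x\in X\}$ and $R\cup R^{-1}=X\times X$. Its set of arcs is $R^\circ=R\setminus 1_X$. It is a topological tournament on a space $X$ when $R$ is closed in $X\times X$. The outset of $x$ is $R^\circ(x)=\{y:(x,y)\in R^\circ\}$ and the inset is $\{y:(y,x)\in R^\circ\}$. A point is balanced when it lies in the closure of its outset and in the closure of its inset; $R$ is balanced when every point is balanced. A 3-cycle is a triple of distinct points with $(x_1,x_2),(x_2,x_3),(x_3,x_1)\in R^\circ$. A point $x$ is a cycle point when every neighborhood of $x$ contains a 3-cycle which includes $x$. *)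

(* Defs.v *)
From HB Require Import structures.
From mathcomp Require Import all_boot all_order all_algebra.
From mathcomp Require Import all_classical.
From mathcomp Require Import topology borel_hierarchy.

Set Implicit Arguments.
Unset Strict Implicit.
Unset Printing Implicit Defensive.

Local Open Scope classical_set_scope.

Section Tournaments.
Context {X : topologicalType}.
Implicit Types (R : set (X * X)) (x : X).

Definition tournament R : Prop :=
  [/\ [set: X] !=set0,
      R `&` (R^-1)%relation = diagonal &
      R `|` (R^-1)%relation = [set: X * X]].

Definition topological_tournament R : Prop := tournament R /\ closed R.

Definition arcs R : set (X * X) := R `\` diagonal.

Definition outset R x : set X := [set y | arcs R (x, y)].

Definition inset R x : set X := [set y | arcs R (y, x)].

Definition balanced_point R x : Prop :=
  closure (outset R x) x /\ closure (inset R x) x.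

Definition balanced_tournament R : Prop := forall x, balanced_point R x.

Definition three_cycle R (x1 x2 x3 : X) : Prop :=
  [/\ x1 <> x2, x2 <> x3 & x3 <> x1] /\
  [/\ arcs R (x1, x2), arcs R (x2, x3) & arcs R (x3, x1)].

Definition cycle_point R x : Prop :=
  forall U : set X, nbhs x U ->
    exists x1 x2 x3 : X,
      [/\ three_cycle R x1 x2 x3,
          [set x1; x2; x3] `<=` U &
          [set x1; x2; x3] x].

End Tournaments.

Definition separable_space (T : topologicalType) : Prop :=
  exists2 D : set T, countable D & dense D.

(* The subtype [set_type A] carries the subspace topology. *)
Definition separable_subset (X : topologicalType) (A : set X) : Prop :=
  separable_space (set_type A).

(* Main.v *)
Require Import Defs.
From HB Require Import structures.
From mathcomp Require Import all_boot all_order all_algebra.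
From mathcomp Require Import zify.
From mathcomp Require Import all_classical wochoice.
From mathcomp Require Import topology borel_hierarchy.

Set Implicit Arguments.
Unset Strict Implicit.
Unset Printing Implicit Defensive.

Import Order.TTheory.

Local Open Scope order_scope.
Local Open Scope classical_set_scope.
Local Open Scope card_scope.

(** The space is a lexicographically ordered tree. Take a complete linear order
L in which every point is either isolated (a node) or a limit from both sides
(a leaf), both endpoints being nodes. A point of X is a sequence of elements
of L that goes on forever through nodes, or stops at the first leaf it meets.
A node contributes a whole copy of the tree, a leaf a single point. Least
upper bounds in X are computed coordinate by coordinate ([tree_lub]), and a
linear order with all least upper bounds is compact ([complete_compact]); X is
totally disconnected because the jumps between consecutive nodes separate
points ([tree_totally_disconnected]).

On L consider the order relation, with one arc reversed: the top beats the
bottom instead of losing to it. Two points of X are compared by this relation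
at the first coordinate where they differ. The result is closed because the
two endpoints of L, where the relation departs from the order, are isolated
([arc_nbhs]). An infinite sequence x is determined by its cylinders: each of
them, cut at a level n, offers every element of L as an alternative to x n.
The relation on L has no source and no sink, so x is balanced; and every node
of L lies on a 3-cycle through the top and the bottom, so x is a cycle point.
A sequence that stops at a leaf q is balanced because q is a limit from both
sides and the relation is the order near q; for the same reason it is not a
cycle point ([leaf_no_cycle]). Hence the cycle points are exactly the infinite
sequences ([cycle_pointsE]), which form a countable intersection of open sets
and are dense because the nodes accumulate at each leaf.

Every nonempty open set contains a cylinder ([open_contains_cylinder]), and a
cylinder contains a copy of all of L. So the three remaining properties are
about L alone: it should have at least as many nodes as the given cardinal,
which gives the lower bound on cardinalities and, through disjoint cylinders,
nonseparability; and it should have a leaf that no sequence approaches from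
below, which gives the points that are not G-delta.

Such an L consists of the down-closed subsets of a linear order J with
endpoints in which each element has an immediate neighbor on each side, except beyond the
endpoints ([cut_branching_order]): the nodes are the empty cut and the principal ones.
For J take a well-order of K with each point replaced by a copy of the
integers, the negative half of the first copy being moved to the far end so
that endpoints appear. The cut consisting of the blocks with only countably
many predecessors has uncountable cofinality, since K is uncountable
([countable_rank_unbounded]). *)

Lemma inj_into_card_le (K T : Type) (A : set T) (g : K -> T) :
  injective g -> (forall k, A (g k)) -> [set: K] #<= A.
Proof.
move=> ginj gA; apply: (@card_le_trans _ _ _ (range g)).
  by have /card_eqPle[] := inj_card_eq (in2W ginj : {in [set: K] &, injective g}).
by apply: subset_card_le => _ [k _ <-].
Qed.

(** * Complete linear orders *)

Definition is_lub d (T : porderType d) (A : set T) (c : T) : Prop :=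
  (forall a, A a -> a <= c) /\ (forall b, (forall a, A a -> a <= b) -> c <= b).

Lemma lub_lt d (T : orderType d) (A : set T) (c b : T) :
  is_lub A c -> b < c -> exists2 a, A a & b < a.
Proof.
move=> [_ least] bc; apply: contrapT => noA.
suff : c <= b by rewrite leNgt bc.
by apply: least => a Aa; rewrite leNgt; apply/negP => ba; apply: noA; exists a.
Qed.

(** An ultrafilter converges to the least upper bound of the points x whose
closed upper ray it contains: below that bound by choice of such an x, above
it because the complement of a ray outside the ultrafilter is inside. *)
Lemma complete_compact d (X : orderTopologicalType d) :
  (forall A : set X, exists c, is_lub A c) -> compact [set: X].
Proof.
move=> lubX; rewrite compact_ultra => F UF _.
have [p lubp] := lubX [set x | F `[x, +oo[].
exists p; split => // U; rewrite itv_nbhsE => -[i [iopen pi] iU].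
have Flt b : p < b -> F `]-oo, b[.
  move=> pb; have [Fb|] := in_ultra_setVsetC `[b, +oo[ UF; last by rewrite setCitvr.
  by have := lubp.1 _ Fb; rewrite leNgt pb.
have Fgt a : a < p -> F `]a, +oo[.
  move=> ap; have [c /= Fc ac] := lub_lt lubp ap.
  apply: filterS Fc => y /=; rewrite !in_itv/= !andbT; exact: lt_le_trans.
apply: filterS iU _.
case: i iopen pi => [[[]a|[]]] [[]b|[]]// _; rewrite in_itv/= ?andbT.
- move=> /andP[ap pb]; apply: filterS (filterI (Fgt _ ap) (Flt _ pb)) => y /=.
  by rewrite !in_itv/= andbT => -[-> ->].
- by move=> /Fgt.
- by move=> /Flt.
- by move=> _; rewrite set_itvE; exact: filterT.
Qed.

(** * Branching orders *)

(** A complete order whose points are of two kinds: nodes, which are isolated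
with neighbors that are again nodes, and leaves, which are limits of nodes from
both sides. The neighbor of a node is given by the equality of two rays, the
form in which it is used to turn open rays into closed ones. The inner node is
the third vertex of the 3-cycles. *)
Record branching_order d (L : tbOrderType d) (node : {pred L}) : Prop := {
  branching_lub : forall A : set L, exists c, is_lub A c;
  node_bot : \bot \in node;
  node_top : \top \in node;
  inner_node : exists2 c, c \in node & \bot < c < \top;
  node_pred : forall c, c \in node -> c != \bot ->
    exists2 a, a \in node & forall b, (b < c) = (b <= a);
  node_succ : forall c, c \in node -> c != \top ->
    exists2 a, a \in node & forall b, (c < b) = (a <= b);
  leaf_left : forall q a, q \notin node -> a < q ->
    exists2 c, c \in node & a < c < q;
  leaf_right : forall q b, q \notin node -> q < b ->
    exists2 c, c \in node & q < c < b }.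

(** * The tree space *)

Section Tree.
Context {d : Order.disp_t} (L : tbOrderType d) (node : {pred L}).

(** Sequences that end at a leaf are padded by the bottom element. The padding
never creates two points from one, since the first leaf marks where it begins. *)
Definition stops_at_leaf (x : big_lexi_order (fun _ : nat => L)) : bool :=
  `[< forall m n, (m < n)%N -> x m \notin node -> x n = \bot >].

Record tree_path := TreePath {
  path_val :> big_lexi_order (fun _ : nat => L);
  _ : stops_at_leaf path_val }.

HB.instance Definition _ := [isSub for path_val].
HB.instance Definition _ := [Choice of tree_path by <:].
HB.instance Definition _ := [SubChoice_isSubOrder of tree_path by <: with d].

Definition tree_space : Type := order_topology tree_path.
HB.instance Definition _ := Choice.on tree_space.
HB.instance Definition _ := OrderTopological.on tree_space.

Local Notation X := tree_space.
Implicit Types (x y z : X) (a b c : L).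

Definition coord x (n : nat) : L := path_val x n.

Definition agree (n : nat) x y := forall m, (m < n)%N -> coord x m = coord y m.

Definition nodes_below (n : nat) x := forall m, (m < n)%N -> coord x m \in node.

Definition cylinder (n : nat) x : set X := [set y | agree n x y].

Lemma agree_sym n x y : agree n x y -> agree n y x.
Proof. by move=> xy m mn; rewrite xy. Qed.

Lemma agree_trans n y x z : agree n x y -> agree n y z -> agree n x z.
Proof. by move=> xy yz m mn; rewrite xy// yz. Qed.

Lemma agree_le m n x y : (m <= n)%N -> agree n x y -> agree m x y.
Proof. by move=> mn xy k km; apply: xy; exact: leq_trans mn. Qed.

Lemma agreeS n x y : agree n x y -> coord x n = coord y n -> agree n.+1 x y.
Proof.
by move=> xy E m; rewrite ltnS leq_eqVlt => /predU1P[->//|]; exact: xy.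
Qed.

Lemma nodes_belowS n x :
  nodes_below n x -> coord x n \in node -> nodes_below n.+1 x.
Proof.
by move=> nx xn m; rewrite ltnS leq_eqVlt => /predU1P[->//|]; exact: nx.
Qed.

Lemma nodes_below_le m n x : (m <= n)%N -> nodes_below n x -> nodes_below m x.
Proof. by move=> mn nx k km; apply: nx; exact: leq_trans mn. Qed.

Lemma nodes_below_agree n x y : agree n x y -> nodes_below n x -> nodes_below n y.
Proof. by move=> xy nx m mn; rewrite -xy// nx. Qed.

Lemma coord_leaf x m n : (m < n)%N -> coord x m \notin node -> coord x n = \bot.
Proof. by case: x => p /= /asboolP; exact. Qed.

Lemma coord_inj x y : coord x =1 coord y -> x = y.
Proof. by move=> E; apply/val_inj/funext. Qed.

Lemma first_difference x y :
  x <> y -> exists2 n, agree n x y & coord x n != coord y n.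
Proof.
move=> xy; case E : (first_diff (path_val x) (path_val y)) => [n|].
  by have /first_diff_SomeP[? ?] := E; exists n.
by have /first_diff_NoneP/val_inj/xy := E.
Qed.

Lemma first_difference_unique m n x y :
  agree m x y -> coord x m != coord y m ->
  agree n x y -> coord x n != coord y n -> m = n.
Proof. exact: (@first_diff_unique _ (path_val x) (path_val y)). Qed.

Lemma tree_leP x y n :
  agree n x y -> coord x n != coord y n -> (x <= y) = (coord x n <= coord y n).
Proof.
move=> xy xyn; change ((path_val x <= path_val y) = (coord x n <= coord y n)).
rewrite leEbig_lexi_order.
by have /first_diff_SomeP -> : same_prefix n (path_val x) (path_val y) /\
  path_val x n != path_val y n by [].
Qed.

Lemma tree_lt n x y : agree n x y -> coord x n < coord y n -> x < y.
Proof.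
move=> xy xyn; have N : coord x n != coord y n by rewrite lt_eqF.
rewrite lt_neqAle (tree_leP xy N) ltW// andbT.
by apply: contra_neq N => ->.
Qed.

Lemma tree_ltP x y :
  x < y -> exists2 n, agree n x y & coord x n < coord y n.
Proof.
rewrite lt_neqAle => /andP[/eqP xy].
have [n An N] := first_difference xy; rewrite (tree_leP An N) => le_n.
by exists n => //; rewrite lt_neqAle N.
Qed.

(** Two points that meet the same leaf are padded identically, so they cannot
differ later. *)
Lemma nodes_below_diff n x y :
  agree n x y -> coord x n != coord y n -> nodes_below n x.
Proof.
move=> xy N m mn; apply/negPn/negP => leaf; move/eqP: N; apply.
by rewrite (coord_leaf mn leaf) (coord_leaf mn)// -xy.
Qed.

Hypothesis bL : branching_order node.

(** The sequence that follows x below n, takes the value c at n and, if c is a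
node, is then constantly t. With t the bottom (the top) it is the least (the greatest) point
of the tree hanging below c. *)
Definition graft_path n x c t (m : nat) : L :=
  if (m < n)%N then coord x m
  else if m == n then c else if c \in node then t else \bot.

Lemma graft_exists n x c t : nodes_below n x -> t \in node ->
  exists y : X, coord y =1 graft_path n x c t.
Proof.
move=> nx tn.
suff S : stops_at_leaf (graft_path n x c t) by exists (TreePath S).
apply/asboolP => i j ij; rewrite /graft_path.
case: (ltnP i n) => [/nx -> //|ni].
have nj : (n < j)%N by exact: leq_ltn_trans ij.
rewrite ltnNge (ltnW nj)/= (gtn_eqF nj).
have [_|_] := eqVneq i n; first by move/negPf ->.
by case: ifP => //; rewrite ?tn// (node_bot bL).
Qed.

Lemma graft_agree n x c t y : coord y =1 graft_path n x c t -> agree n x y.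
Proof. by move=> E m mn; rewrite E /graft_path mn. Qed.

Lemma graft_at n x c t y : coord y =1 graft_path n x c t -> coord y n = c.
Proof. by move=> E; rewrite E /graft_path ltnn eqxx. Qed.

Lemma graft_after n x c t y m : coord y =1 graft_path n x c t -> (n < m)%N ->
  coord y m = if c \in node then t else \bot.
Proof. by move=> E nm; rewrite E /graft_path ltnNge (ltnW nm)/= gtn_eqF. Qed.

Lemma child_exists n x c : nodes_below n x ->
  exists y : X, [/\ agree n x y, coord y n = c &
    forall m, (n < m)%N -> coord y m = \bot].
Proof.
move=> nx; have [y E] := graft_exists c nx (node_bot bL).
exists y; split; [exact: graft_agree E|exact: graft_at E|].
by move=> m nm; rewrite (graft_after E nm) if_same.
Qed.

(** The bound z is built greedily: z n is the least upper bound of the n-th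
coordinates of those members of A that follow z below n. If z n is not attained
no member follows z past n, and the later coordinates are lower bounds of the
empty family, that is the bottom; the same padding appears when z n is a leaf,
so z is a point of the tree. *)
Lemma tree_lub (A : set X) : exists z, is_lub A z.
Proof.
pose lub (B : set L) := sval (cid (branching_lub bL B)).
have lubP B : is_lub B (lub B) by rewrite /lub; case: cid.
pose fix S n : set X := if n is m.+1
  then S m `&` [set x | coord x m = lub [set coord y m | y in S m]] else A.
pose z n := lub [set coord y n | y in S n].
have S_agree n x : S n x <-> A x /\ forall m, (m < n)%N -> coord x m = z m.
  elim: n x => [|n IH] x; first by split=> [Ax|[]].
  split=> [[/= /IH[Ax xz] xn]|[Ax xz]].
    by split=> // m; rewrite ltnS leq_eqVlt => /predU1P[->//|]; exact: xz.
  split; last exact: xz.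
  by apply/IH; split=> // m mn; apply: xz; exact: leq_trans mn _.
have S_z : stops_at_leaf z.
  apply/asboolP => m n mn leaf; apply/eqP; rewrite -lex0.
  apply: (lubP _).2 => _ [y /S_agree[_ yz] <-].
  by rewrite (coord_leaf mn)// yz.
exists (TreePath S_z : X); split=> [x Ax|y ub].
  have [->//|/eqP/first_difference[n xz N]] := eqVneq x (TreePath S_z : X).
  rewrite (tree_leP xz N); apply: (lubP _).1; exists x => //.
  exact/S_agree.
rewrite leNgt; apply/negP => /tree_ltP[n yz].
move=> /(lub_lt (lubP _))[_ [x /S_agree[Ax xz] <-]] yx.
have := ub _ Ax; rewrite leNgt (@tree_lt n)//.
by move=> m mn; rewrite yz//= xz.
Qed.

(** Inside a cylinder the condition a < y n is an open ray of X: its endpoint is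
the greatest point of the subtree below a, which exists because a is a node. *)
Lemma above_open n x a : nodes_below n x -> a \in node ->
  open (cylinder n x) -> open (cylinder n x `&` [set y : X | a < coord y n]).
Proof.
move=> nx an oC; have [u E] := graft_exists a nx (node_top bL).
suff -> : cylinder n x `&` [set y : X | a < coord y n] =
    cylinder n x `&` `]u, +oo[ by apply: openI => //; exact: rray_open.
apply/seteqP; split=> y [xy /=]; rewrite in_itv/= andbT.
  move=> ay; split=> //; apply: (@tree_lt n); last by rewrite (graft_at E).
  by apply: agree_trans xy; apply: agree_sym; exact: graft_agree E.
move=> /tree_ltP[m uy um]; split=> //.
have [mn|nm|mn] := ltngtP m n.
- by move: um; rewrite -(graft_agree E)// -xy// ltxx.
- by move: um; rewrite (graft_after E nm) an ltNge lex1.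
- by move: um; rewrite mn (graft_at E).
Qed.

Lemma below_open n x b : nodes_below n x -> b \in node ->
  open (cylinder n x) -> open (cylinder n x `&` [set y : X | coord y n < b]).
Proof.
move=> nx bn oC; have [v E] := graft_exists b nx (node_bot bL).
suff -> : cylinder n x `&` [set y : X | coord y n < b] =
    cylinder n x `&` `]-oo, v[ by apply: openI => //; exact: lray_open.
apply/seteqP; split=> y [xy /=]; rewrite in_itv/=.
  move=> yb; split=> //; apply: (@tree_lt n); last by rewrite (graft_at E).
  by apply: agree_trans (graft_agree E); exact: agree_sym.
move=> /tree_ltP[m yv ym]; split=> //.
have [mn|nm|mn] := ltngtP m n.
- by move: ym; rewrite -(graft_agree E)// -xy// ltxx.
- by move: ym; rewrite (graft_after E nm) bn ltx0.
- by move: ym; rewrite mn (graft_at E).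
Qed.

Lemma cylinder0 x : cylinder 0 x = setT.
Proof. by apply/seteqP; split. Qed.

Lemma cylinderS n x : cylinder n.+1 x =
  cylinder n x `&` [set y : X | coord y n = coord x n].
Proof.
apply/seteqP; split=> [y xy|y [xy /= E]]; last exact: agreeS.
by split; [exact: agree_le xy|rewrite /= xy].
Qed.

(** The n-th coordinate of x is a node, hence isolated in L by nodes: fixing it
amounts to placing the coordinate strictly between its two neighbors. *)
Lemma cylinder_open n x : nodes_below n x -> open (cylinder n x).
Proof.
elim: n => [|n IH] nx; first by rewrite cylinder0; exact: openT.
have nx' : nodes_below n x by exact: nodes_below_le nx.
have oC := IH nx'; have xn : coord x n \in node by exact: nx.
rewrite cylinderS.
have oA : open (cylinder n x `&` [set y : X | coord x n <= coord y n]).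
  have [->|x0] := eqVneq (coord x n) \bot.
    rewrite (_ : [set y | _] = setT) ?setIT//.
    by apply/seteqP; split=> // y _ /=; exact: le0x.
  have [a an aP] := node_pred bL xn x0.
  rewrite (_ : [set y | _] = [set y | a < coord y n]); first exact: above_open.
  by apply/seteqP; split=> y /=; rewrite leNgt aP -ltNge.
have oB : open (cylinder n x `&` [set y : X | coord y n <= coord x n]).
  have [->|x1] := eqVneq (coord x n) \top.
    rewrite (_ : [set y | _] = setT) ?setIT//.
    by apply/seteqP; split=> // y _ /=; exact: lex1.
  have [b bn bP] := node_succ bL xn x1.
  rewrite (_ : [set y | _] = [set y | coord y n < b]); first exact: below_open.
  by apply/seteqP; split=> y /=; rewrite leNgt bP -ltNge.
rewrite (_ : _ `&` _ = (cylinder n x `&` [set y | coord x n <= coord y n]) `&`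
  (cylinder n x `&` [set y | coord y n <= coord x n])); first exact: openI.
apply/seteqP; split=> y /=; first by move=> [xy ->].
by move=> [[xy xley] [_ ylex]]; split=> //; apply/eqP; rewrite eq_le ylex.
Qed.

(** A point y other than x differs from x at some level, and everything that
follows x past this level lies on the same side of y as x does. *)
Lemma nbhs_cylinder x (U : set X) : nbhs x U -> exists n, cylinder n x `<=` U.
Proof.
rewrite itv_nbhsE => -[i [iopen xi] iU].
have lt_cyl y : y < x -> exists n, forall z, agree n x z -> y < z.
  move=> /tree_ltP[n yx yxn]; exists n.+1 => z xz.
  apply: (@tree_lt n); last by rewrite -xz.
  by apply: agree_trans yx _; exact: agree_le xz.
have gt_cyl y : x < y -> exists n, forall z, agree n x z -> z < y.
  move=> /tree_ltP[n xy xyn]; exists n.+1 => z xz.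
  apply: (@tree_lt n); last by rewrite -xz.
  by apply: agree_trans xy; apply: agree_sym; exact: agree_le xz.
case: i iopen xi iU => [[[]a|[]]] [[]b|[]]// _; rewrite in_itv/= ?andbT.
- move=> /andP[/lt_cyl[m ltm] /gt_cyl[n gtn]] iU; exists (maxn m n) => z xz.
  apply: iU; rewrite /= in_itv/= ltm ?gtn//.
    exact: agree_le (leq_maxr _ _) xz.
  exact: agree_le (leq_maxl _ _) xz.
- move=> /lt_cyl[m ltm] iU; exists m => z xz; apply: iU.
  by rewrite /= in_itv/= ltm.
- move=> /gt_cyl[m ltm] iU; exists m => z xz; apply: iU.
  by rewrite /= in_itv/= ltm.
- by move=> _ iU; exists 0 => z xz; apply: iU.
Qed.

Definition leaf_window n x a b : set X :=
  cylinder n x `&` [set y : X | a < coord y n < b].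

(** At a leaf the cylinders shrink to the point itself, which is not open. The
windows are the right substitute: a point y of X on one side of x either
branches off before the leaf, or has an n-th coordinate that nodes separate
from the leaf. *)
Lemma nbhs_leaf n x (U : set X) : coord x n \notin node -> nbhs x U ->
  exists a b, [/\ a \in node, b \in node, a < coord x n < b &
    leaf_window n x a b `<=` U].
Proof.
move=> leaf; rewrite itv_nbhsE => -[i [iopen xi] iU].
have bx : \bot < coord x n.
  by rewrite lt0x; apply: contraNneq leaf => ->; exact: node_bot bL.
have xt : coord x n < \top.
  by rewrite ltx1; apply: contraNneq leaf => ->; exact: node_top bL.
have lt_win y : y < x -> exists a, [/\ a \in node, a < coord x n &
    forall z, agree n x z -> a < coord z n -> y < z].
  move=> /tree_ltP[m yx yxm]; have [mn|nm|mn] := ltngtP m n.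
  - exists \bot; split=> //; first exact: node_bot bL.
    move=> z xz _; apply: (@tree_lt m); last by rewrite -xz.
    by apply: agree_trans yx _; apply: agree_le xz; exact: ltnW.
  - by move: yxm; rewrite (coord_leaf nm leaf) ltx0.
  - move: m mn => _ -> in yx yxm *.
    have [a an /andP[ya ax]] := leaf_left bL leaf yxm.
    exists a; split=> // z xz az; apply: (@tree_lt n).
      by apply: agree_trans yx _.
    exact: lt_trans az.
have gt_win y : x < y -> exists a, [/\ a \in node, coord x n < a &
    forall z, agree n x z -> coord z n < a -> z < y].
  move=> /tree_ltP[m xy xym]; have [mn|nm|mn] := ltngtP m n.
  - exists \top; split=> //; first exact: node_top bL.
    move=> z xz _; apply: (@tree_lt m); last by rewrite -xz.
    by apply: agree_trans xy; apply: agree_sym; apply: agree_le xz; exact: ltnW.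
  - by move: xym; rewrite (coord_leaf nm leaf) (coord_leaf nm) ?ltxx// -xy.
  - move: m mn => _ -> in xy xym *.
    have [a an /andP[xa ay]] := leaf_right bL leaf xym.
    exists a; split=> // z xz za; apply: (@tree_lt n).
      by apply: agree_trans xy; exact: agree_sym.
    exact: lt_trans ay.
case: i iopen xi iU => [[[]a|[]]] [[]b|[]]// _; rewrite in_itv/= ?andbT.
- move=> /andP[/lt_win[u [un ux ltz]] /gt_win[v [vn xv gtz]]] iU.
  exists u, v; split=> //; first by rewrite ux.
  by move=> z [xz /= /andP[uz zv]]; apply: iU; rewrite /= in_itv/= ltz ?gtz.
- move=> /lt_win[u [un ux ltz]] iU.
  exists u, \top; split=> //; [exact: node_top bL|by rewrite ux|].
  by move=> z [xz /= /andP[uz _]]; apply: iU; rewrite /= in_itv/= ltz.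
- move=> /gt_win[v [vn xv gtz]] iU.
  exists \bot, v; split=> //; [exact: node_bot bL|by rewrite xv bx|].
  by move=> z [xz /= /andP[_ zv]]; apply: iU; rewrite /= in_itv/= gtz.
- move=> _ iU; exists \bot, \top; split=> //;
    [exact: node_bot bL|exact: node_top bL|by rewrite bx|].
  by move=> z _; apply: iU; rewrite set_itvE.
Qed.

Lemma leaf_window_open n x a b : nodes_below n x -> a \in node -> b \in node ->
  open (leaf_window n x a b).
Proof.
move=> nx an bn; have oC := cylinder_open nx.
rewrite (_ : leaf_window n x a b =
  (cylinder n x `&` [set y : X | a < coord y n]) `&`
  (cylinder n x `&` [set y : X | coord y n < b])).
  by apply: openI; [exact: above_open|exact: below_open].
apply/seteqP; split=> y /=; first by move=> [xy /andP[-> ->]].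
by move=> [[xy ay] [_ yb]]; split=> //=; rewrite ay.
Qed.

Lemma jump_between a b : a < b -> exists c c', [/\ c \in node, c' \in node,
  a <= c, c' <= b & forall e, (c < e) = (c' <= e)].
Proof.
have lt_top (u v : L) : u < v -> u != \top.
  by move=> uv; rewrite -ltx1; exact: lt_le_trans uv (lex1 _).
move=> ab; have [an|leaf] := boolP (a \in node).
  have [c' c'n c'P] := node_succ bL an (lt_top _ _ ab).
  by exists a, c'; split=> //; rewrite -c'P.
have [c cn /andP[ac cb]] := leaf_right bL leaf ab.
have [c' c'n c'P] := node_succ bL cn (lt_top _ _ cb).
by exists c, c'; split=> //; [exact: ltW|rewrite -c'P].
Qed.

(** A jump from c to c' in L becomes a jump in X, from the greatest point below c
to the least point below c', and the upper ray determined by a jump is both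
open and closed. *)
Lemma tree_totally_disconnected : totally_disconnected [set: X].
Proof.
apply: zero_dimension_totally_disconnected.
suff sep (x y : X) : x < y -> exists U : set X, [/\ clopen U, U y & ~ U x].
  move=> x y; rewrite neq_lt => /orP[/sep[U [[oU cU] Uy Ux]]|/sep[U [? ? ?]]].
    by exists (~` U); split=> //; split; [exact: closed_openC|exact: open_closedC].
  by exists U.
move=> /tree_ltP[n xy xyn].
have nx : nodes_below n x by apply: nodes_below_diff xy _; rewrite lt_eqF.
have [c [c' [cn c'n xc c'y cP]]] := jump_between xyn.
have [lo loE] := graft_exists c nx (node_top bL).
have [hi hiE] := graft_exists c' nx (node_bot bL).
have xlo := graft_agree loE; have xhi := graft_agree hiE.
have loc := graft_at loE; have hic := graft_at hiE.
have cc' : c < c' by rewrite cP.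
have lohi z : lo < z -> hi <= z.
  move=> /tree_ltP[m loz lozm]; have [mn|nm|mn] := ltngtP m n.
  - apply/ltW/(@tree_lt m); last by rewrite -xhi// xlo.
    apply: agree_trans (agree_le (ltnW mn) (agree_sym xhi)) _.
    by apply: agree_trans loz; apply: agree_le xlo; exact: ltnW.
  - by move: lozm; rewrite (graft_after loE nm) cn ltNge lex1.
  - rewrite mn in loz lozm.
    have hiz : agree n hi z.
      by apply: agree_trans loz; exact: agree_trans (agree_sym xhi) xlo.
    move: lozm; rewrite loc cP le_eqVlt => /predU1P[zn|]; last first.
      by rewrite -hic => ?; apply/ltW/(@tree_lt n).
    rewrite leNgt; apply/negP => /tree_ltP[k zhi zk].
    have [kn|nk|kn] := ltngtP k n.
    + by move: zk; rewrite hiz// ltxx.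
    + by move: zk; rewrite (graft_after hiE nk) c'n ltx0.
    + by move: zk; rewrite kn hic zn ltxx.
exists `]lo, +oo[; split.
- split; first exact: rray_open.
  rewrite (_ : `]lo, +oo[ = `[hi, +oo[); first exact: rray_closed.
  apply/seteqP; split=> z /=; rewrite !in_itv/= !andbT; first exact: lohi.
  apply: lt_le_trans; apply: (@tree_lt n); last by rewrite loc hic.
  exact: agree_trans (agree_sym xlo) xhi.
- rewrite /= in_itv/= andbT; apply: (@tree_lt n).
    exact: agree_trans (agree_sym xlo) xy.
  by rewrite loc cP.
- rewrite /= in_itv/= andbT => /tree_ltP[m lox lom].
  have [mn|nm|mn] := ltngtP m n.
  + by move: lom; rewrite xlo// ltxx.
  + by move: lom; rewrite (graft_after loE nm) cn ltNge lex1.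
  + by move: lom; rewrite mn loc ltNge xc.
Qed.

(** * The tournament *)

Definition beats a b : bool :=
  (a < b) && ~~ ((a == \bot) && (b == \top)) || (a == \top) && (b == \bot).

Lemma bot_lt_top : (\bot : L) < \top.
Proof. by have [c _ /andP[bc ct]] := inner_node bL; exact: lt_trans ct. Qed.

Lemma beatsxx a : beats a a = false.
Proof.
rewrite /beats ltxx/=; have [->|//] := eqVneq a \top.
by rewrite eq_sym lt_eqF// bot_lt_top.
Qed.

Lemma beatsC a b : a != b -> beats b a = ~~ beats a b.
Proof.
move=> ab; rewrite /beats; have := bot_lt_top; move: ab; rewrite neq_lt.
have bt : (\bot : L) != \top by rewrite lt_eqF// bot_lt_top.
have ntb : (\top : L) != \bot by rewrite eq_sym.
case: ltgtP => // ab _ _ /=.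
- rewrite negb_or negbK andbC.
  have [->|a0] := eqVneq a \bot; have [->|b1] := eqVneq b \top;
    by rewrite ?eqxx ?(negPf bt) ?(negPf ntb) ?andbF ?andbT.
- have [->|a1] := eqVneq a \top; have [->|b0] := eqVneq b \bot;
    by rewrite ?eqxx ?(negPf bt) ?(negPf ntb) ?andbF ?andbT.
Qed.

Definition arc x y : Prop :=
  exists2 n, agree n x y & beats (coord x n) (coord y n).

Definition tree_tournament : set (X * X) :=
  [set p | p.1 = p.2 \/ arc p.1 p.2].

Lemma arc_neq x y : arc x y -> x <> y.
Proof. by move=> [n _ +] xy; rewrite xy beatsxx. Qed.

Lemma arcsE x y : arcs tree_tournament (x, y) = arc x y.
Proof.
apply/propext; split=> [[[/= xy|//] []]|]; first by [].
by move=> xy; split; [right|move=> /= /(arc_neq xy)].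
Qed.

Lemma arc_at n x y :
  agree n x y -> coord x n != coord y n -> arc x y = beats (coord x n) (coord y n).
Proof.
move=> xy N; apply/propext; split=> [[m xy' B]|]; last by exists n.
suff <- : m = n by [].
apply: first_difference_unique xy' _ xy N.
by apply: contraTneq B => ->; rewrite beatsxx.
Qed.

Lemma arcC x y : x <> y -> arc y x = ~ arc x y.
Proof.
move=> /first_difference[n xy N].
rewrite (arc_at xy N) (arc_at (agree_sym xy)) 1?eq_sym// beatsC//.
by apply/propext; split=> /negP.
Qed.

Lemma tree_tournamentP : tournament tree_tournament.
Proof.
split.
- have S : stops_at_leaf (fun=> \bot : L) by apply/asboolP.
  by exists (TreePath S).
- apply/seteqP; split=> -[x y] /=; last by rewrite /diagonal/= => ->; split; left.
  move=> [[//|xy] [//|yx]]; exfalso.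
  by move: yx; rewrite arcC//; exact: arc_neq.
- apply/seteqP; split=> -[x y] //= _.
  have [->|/eqP xy] := eqVneq x y; first by left; left.
  have [|] := pselect (arc x y); first by left; right.
  by rewrite -arcC// => yx; right; right.
Qed.

(** When the coordinates of x and y at their first difference are in increasing
order, a jump between them keeps the order for nearby points; one must also
stay away from the exceptional pair of the bottom and the top. So the first
coordinate is not the bottom or the second is not the top, and this is an open
condition. For the exceptional pair itself both coordinates are
isolated. *)
Lemma arc_nbhs x y : arc x y -> exists U V : set X,
  [/\ nbhs x U, nbhs y V & forall u v, U u -> V v -> arc u v].
Proof.
move=> [n xy B].
have N : coord x n != coord y n by apply: contraTneq B => ->; rewrite beatsxx.
have nx : nodes_below n x := nodes_below_diff xy N.
have ny : nodes_below n y := nodes_below_agree xy nx.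
have oX := cylinder_open nx; have oY := cylinder_open ny.
have near_open (z : X) (W : set X) : open W -> W z -> nbhs z W.
  by move=> ? ?; exact: open_nbhs_nbhs.
have uv_agree u v : cylinder n x u -> cylinder n y v -> agree n u v.
  by move=> xu yv; apply: agree_trans (agree_sym xu) (agree_trans xy yv).
move: B => /orP[/andP[xyn]|/andP[/eqP xt /eqP yb]]; last first.
  exists (cylinder n.+1 x), (cylinder n.+1 y); split.
  - apply: near_open => //; apply: cylinder_open; apply: nodes_belowS => //.
    by rewrite xt (node_top bL).
  - apply: near_open => //; apply: cylinder_open; apply: nodes_belowS => //.
    by rewrite yb (node_bot bL).
  - move=> u v xu yv; exists n; last by rewrite -xu// -yv// xt yb /beats !eqxx orbT.
    by apply: uv_agree; [exact: agree_le xu|exact: agree_le yv].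
have [c [c' [cn c'n xc c'y cP]]] := jump_between xyn.
have xc' : coord x n < c' by rewrite (le_lt_trans xc)// cP.
have cy : c < coord y n by rewrite cP.
rewrite negb_and => /orP[x0|y1].
  exists (leaf_window n x \bot c'),
    (cylinder n y `&` [set z | c < coord z n]); split.
  - apply: near_open; first exact/leaf_window_open/c'n/(node_bot bL).
    by split=> //=; rewrite lt0x x0.
  - by apply: near_open => //; exact: above_open.
  - move=> u v [xu /= /andP[u0 uc]] [yv /= vc]; exists n; first exact: uv_agree.
    rewrite /beats negb_and -lt0x u0/= andbT; apply/orP; left.
    by move: vc; rewrite cP; exact: lt_le_trans.
exists (cylinder n x `&` [set z | coord z n < c']),
  (leaf_window n y c \top); split.
- by apply: near_open => //; exact: below_open.
- apply: near_open; first exact/leaf_window_open/(node_top bL)/cn.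
  by split=> //=; rewrite ltx1 y1 cy.
- move=> u v [xu /= uc] [yv /= /andP[vc v1]]; exists n; first exact: uv_agree.
  rewrite /beats negb_and -(ltx1 (coord v n)) v1 orbT andbT; apply/orP; left.
  by move: vc; rewrite cP; exact: lt_le_trans.
Qed.

Lemma tree_topological_tournament : topological_tournament tree_tournament.
Proof.
split; first exact: tree_tournamentP.
rewrite -openC openE => -[x y] /= /not_orP[/= xy]; rewrite -arcC//.
move=> /arc_nbhs[V [U [yV xU UV]]].
exists (U, V) => //= -[u v] [/= Uu Vv].
have vu : arc v u by exact: UV.
by apply/not_orP; split=> [/esym|]; [exact: arc_neq|rewrite -arcC//; exact/nesym/arc_neq].
Qed.

(** * Balanced points and cycle points *)

Lemma nodes_below_leaf n x : coord x n \notin node -> nodes_below n x.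
Proof.
move=> leaf m mn; apply/negPn/negP => mleaf.
by move: leaf; rewrite (coord_leaf mn mleaf) (node_bot bL).
Qed.

Lemma leaf_inner n x : coord x n \notin node -> \bot < coord x n < \top.
Proof.
move=> leaf; rewrite lt0x ltx1; apply/andP; split; apply: contraNneq leaf => ->.
  exact: node_bot bL.
exact: node_top bL.
Qed.

Lemma branch_or_leaf x :
  (forall n, coord x n \in node) \/ exists n, coord x n \notin node.
Proof.
have [|/existsNP[n /negP leaf]] := pselect (forall n, coord x n \in node).
  by left.
by right; exists n.
Qed.

Lemma arc_child n x y : agree n x y -> beats (coord x n) (coord y n) -> arc x y.
Proof. by move=> xy B; exists n. Qed.

Lemma beats_lt a b : a < b -> (\bot < a) || (b < \top) -> beats a b.
Proof. by move=> ab; rewrite lt0x ltx1 -negb_and /beats ab => ->. Qed.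

Lemma beats_top_bot : beats \top \bot.
Proof. by rewrite /beats !eqxx orbT. Qed.

(** Reversing the arc between the endpoints of L removes the source and the sink
that the order has. *)
Lemma beats_out a : a \in node -> exists2 b, b \in node & beats a b.
Proof.
move=> an; have [c cn /andP[bc ct]] := inner_node bL.
have [a1|a1] := eqVneq a \top.
  by exists \bot; [exact: node_bot bL|rewrite a1 beats_top_bot].
have [a0|a0] := eqVneq a \bot; first by exists c => //; rewrite a0 beats_lt ?ct ?orbT.
by exists \top; [exact: node_top bL|rewrite beats_lt ?ltx1// lt0x a0].
Qed.

Lemma beats_in a : a \in node -> exists2 b, b \in node & beats b a.
Proof.
move=> an; have [c cn /andP[bc ct]] := inner_node bL.
have [a0|a0] := eqVneq a \bot.
  by exists \top; [exact: node_top bL|rewrite a0 beats_top_bot].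
have [a1|a1] := eqVneq a \top; first by exists c => //; rewrite a1 beats_lt ?bc.
by exists \bot; [exact: node_bot bL|rewrite beats_lt ?lt0x// ltx1 a1 orbT].
Qed.

(** Within a cylinder around an infinite sequence there is no source and no sink.
Around a leaf the tournament is the order, and the leaf is approached from both
sides. *)
Lemma tree_balanced : balanced_tournament tree_tournament.
Proof.
move=> x; suff near U : nbhs x U ->
    (exists2 y, U y & arc x y) /\ (exists2 y, U y & arc y x).
  split=> U /near[[y Uy xy] [z Uz zx]].
    by exists y; split=> //; rewrite /outset/= arcsE.
  by exists z; split=> //; rewrite /inset/= arcsE.
have [branch|[n leaf]] := branch_or_leaf x => Ux.
  have [n nU] := nbhs_cylinder Ux.
  have nx : nodes_below n x by move=> m _; exact: branch.
  have [b _ xb] := beats_out (branch n).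
  have [a _ ax] := beats_in (branch n).
  have [y [xy yn _]] := child_exists b nx.
  have [z [xz zn _]] := child_exists a nx.
  split; [exists y|exists z]; do ?exact: nU.
    by apply: (arc_child xy); rewrite yn.
  by apply: (arc_child (agree_sym xz)); rewrite zn.
have nx := nodes_below_leaf leaf; have /andP[bx xt] := leaf_inner leaf.
have [a [b [an bn /andP[ax xb] winU]]] := nbhs_leaf leaf Ux.
have [u un /andP[au ux]] := leaf_left bL leaf ax.
have [v vn /andP[xv vb]] := leaf_right bL leaf xb.
have [y [xy yn _]] := child_exists v nx.
have [z [xz zn _]] := child_exists u nx.
split; [exists y|exists z].
- by apply: winU; split=> //=; rewrite yn vb andbT (lt_trans ax).
- by apply: (arc_child xy); rewrite yn beats_lt// bx.
- by apply: winU; split=> //=; rewrite zn au (lt_trans ux).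
- by apply: (arc_child (agree_sym xz)); rewrite zn beats_lt// xt orbT.
Qed.

(** Taking x itself when the prescribed coordinate is that of x lets one place x
on a cycle without distinguishing which of the three vertices it is. *)
Lemma child_exists_at n x c : nodes_below n x ->
  exists y : X, [/\ agree n x y, coord y n = c & c = coord x n -> y = x].
Proof.
move=> nx; have [->|cx] := eqVneq c (coord x n); first by exists x.
have [y [xy yc _]] := child_exists c nx.
by exists y; split=> // E; rewrite E eqxx in cx.
Qed.

(** The cycle is bottom, c, top at level n, where c is the coordinate of x
there, or any inner node when x is at an endpoint. *)
Lemma branch_cycle_point x :
  (forall n, coord x n \in node) -> cycle_point tree_tournament x.
Proof.
move=> branch U /nbhs_cylinder[n nU].
have nx : nodes_below n x by move=> m _; exact: branch.
have [c /andP[bc ct] xc] : exists2 c, \bot < c < \top &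
    [\/ coord x n = \bot, coord x n = c | coord x n = \top].
  have [c _ cin] := inner_node bL.
  have [x0|x0] := eqVneq (coord x n) \bot; first by exists c => //; constructor 1.
  have [x1|x1] := eqVneq (coord x n) \top; first by exists c => //; constructor 3.
  by exists (coord x n); [rewrite lt0x x0 ltx1|constructor 2].
have [x1 [xx1 x1n x1x]] := child_exists_at \bot nx.
have [x2 [xx2 x2n x2x]] := child_exists_at c nx.
have [x3 [xx3 x3n x3x]] := child_exists_at \top nx.
have arc12 : arc x1 x2.
  by apply: (arc_child (agree_trans (agree_sym xx1) xx2)); rewrite x1n x2n beats_lt// ct orbT.
have arc23 : arc x2 x3.
  by apply: (arc_child (agree_trans (agree_sym xx2) xx3)); rewrite x2n x3n beats_lt// bc.
have arc31 : arc x3 x1.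
  by apply: (arc_child (agree_trans (agree_sym xx3) xx1)); rewrite x3n x1n beats_top_bot.
exists x1, x2, x3; split.
- by split; split; rewrite ?arcsE//; exact: arc_neq.
- by move=> _ [[->|->]|->]; exact: nU.
- case: xc => E; [left; left|left; right|right]; rewrite /= ?x1x ?x2x ?x3x//.
Qed.

(** Near a leaf x = s q the first difference with x is always at the level of q,
where the endpoints of L are excluded. So x beats y and z beats x only if
z n < q < y n, and then y cannot beat z. *)
Lemma leaf_no_cycle n x y z : coord x n \notin node ->
  leaf_window n x \bot \top y -> leaf_window n x \bot \top z ->
  arc x y -> arc y z -> ~ arc z x.
Proof.
move=> leaf [xy /= /andP[y0 y1]] [xz /= /andP[z0 z1]] axy ayz azx.
have eq_x w : agree n x w -> coord w n = coord x n -> w = x.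
  move=> xw E; apply: coord_inj => m; have [mn|nm|->//] := ltngtP m n.
    by rewrite xw.
  by rewrite (coord_leaf nm) ?E// (coord_leaf nm).
have neq w : x <> w -> agree n x w -> coord x n != coord w n.
  by move=> xw Aw; apply/eqP => E; apply: xw; rewrite (eq_x w).
have lt_arc u w : agree n x u -> agree n x w -> coord u n < \top ->
    coord u n != coord w n -> arc u w -> coord u n < coord w n.
  move=> xu xw u1 N; rewrite (arc_at (agree_trans (agree_sym xu) xw) N).
  by rewrite /beats (lt_eqF u1)/= orbF => /andP[].
have xyn : coord x n < coord y n.
  apply: lt_arc => //; first by case/andP: (leaf_inner leaf).
  exact/neq/xy/arc_neq.
have zxn : coord z n < coord x n.
  apply: lt_arc => //; rewrite eq_sym; apply: neq => //.
  exact/nesym/arc_neq.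
have zyn := lt_trans zxn xyn.
have yzn : coord y n < coord z n.
  by apply: lt_arc => //; rewrite gt_eqF.
by move: (lt_trans yzn zyn); rewrite ltxx.
Qed.

Lemma cycle_pointsE :
  [set x | cycle_point tree_tournament x] = [set x | forall n, coord x n \in node].
Proof.
apply/seteqP; split=> x /=; last exact: branch_cycle_point.
move=> cyc; have [//|[n leaf]] := branch_or_leaf x; exfalso.
have win_nbhs : nbhs x (leaf_window n x \bot \top).
  apply: open_nbhs_nbhs; split; last by split=> //=; exact: leaf_inner.
  apply: leaf_window_open; [exact: nodes_below_leaf|exact: node_bot bL|exact: node_top bL].
have [x1 [x2 [x3 [[_ []]]]]] := cyc _ win_nbhs.
rewrite !arcsE => a12 a23 a31 win.
have w1 : leaf_window n x \bot \top x1 by apply: win; left; left.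
have w2 : leaf_window n x \bot \top x2 by apply: win; left; right.
have w3 : leaf_window n x \bot \top x3 by apply: win; right.
move=> [[]|] /= E; rewrite -E in a12 a23 a31.
- exact: (leaf_no_cycle leaf w2 w3 a12 a23 a31).
- exact: (leaf_no_cycle leaf w3 w1 a23 a31 a12).
- exact: (leaf_no_cycle leaf w1 w2 a31 a12 a23).
Qed.

(** * Nonempty open sets contain trees *)

Lemma open_contains_cylinder (U : set X) : open U -> U !=set0 ->
  exists x n, [/\ forall m, coord x m \in node & cylinder n x `<=` U].
Proof.
move=> oU [x Ux]; have Unbhs : nbhs x U by exact: open_nbhs_nbhs.
have [branch|[n leaf]] := branch_or_leaf x.
  by have [n nU] := nbhs_cylinder Unbhs; exists x, n.
have [a [b [an bn /andP[ax xb] winU]]] := nbhs_leaf leaf Unbhs.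
have [u un /andP[au ux]] := leaf_left bL leaf ax.
have nx := nodes_below_leaf leaf.
have [y [xy yn ybot]] := child_exists u nx.
exists y, n.+1; split.
  move=> m; have [mn|nm|->] := ltngtP m n.
  - by rewrite -xy// nx.
  - by rewrite ybot// (node_bot bL).
  - by rewrite yn.
move=> z; rewrite cylinderS => -[yz /= zn]; apply: winU; split=> /=.
  exact: agree_trans yz.
by rewrite zn yn au (lt_trans ux).
Qed.

Lemma dense_cycle_points : dense [set x | cycle_point tree_tournament x].
Proof.
rewrite cycle_pointsE => U U0 oU.
have [x [n [branch nU]]] := open_contains_cylinder oU U0.
by exists x; split=> //; exact: nU.
Qed.

(** The sequences that pass through nodes up to level n form an open set. *)
Lemma Gdelta_cycle_points : Gdelta [set x | cycle_point tree_tournament x].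
Proof.
rewrite cycle_pointsE; exists nodes_below.
  move=> n; rewrite openE => x nx; rewrite /interior.
  apply: filterS (open_nbhs_nbhs (conj (cylinder_open nx) _)) => // y xy.
  exact: nodes_below_agree xy nx.
apply/seteqP; split=> [x xn n _ m _|x xn n]; first exact: xn.
exact: (xn n.+1 I n).
Qed.

(** If countably many open sets contain the point s q, their windows have lower
ends below q with a common strict bound b below q, and the points s b are in
all of these open sets. *)
Lemma dense_non_Gdelta (q : L) : q \notin node ->
  (forall c : nat -> L, (forall n, c n < q) -> exists2 b, b < q & forall n, c n < b) ->
  dense [set x : X | ~ Gdelta [set x]].
Proof.
move=> leaf unctble U U0 oU.
have [x [n [branch nU]]] := open_contains_cylinder oU U0.
have [y [xy yn _]] := child_exists q (fun m (_ : (m < n)%N) => branch m).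
exists y; split; first exact: nU.
move=> [F oF FE].
have yleaf : coord y n \notin node by rewrite yn.
have yF i : nbhs y (F i).
  apply: open_nbhs_nbhs; split=> //.
  have : (\bigcap_i F i) y by rewrite -FE.
  exact.
have /choice[c cP] i : exists a, a < q /\
    forall z, agree n y z -> a < coord z n <= q -> F i z.
  have [a [b [_ _ /andP[ay yb] winF]]] := nbhs_leaf yleaf (yF i).
  exists a; rewrite -yn; split=> // z yz /andP[az zy].
  by apply: winF; split=> //=; rewrite az (le_lt_trans zy).
have [b bq cb] := unctble c (fun i => (cP i).1).
have [z [yz zn _]] := child_exists b (nodes_below_leaf yleaf).
have : (\bigcap_i F i) z.
  by move=> i _; apply: (cP i).2 => //; rewrite zn cb ltW.
by rewrite -FE /= => zy; move: bq; rewrite -zn zy yn ltxx.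
Qed.

Lemma open_card (K : Type) (f : K -> L) (U : set X) : injective f ->
  open U -> U !=set0 -> [set: K] #<= U.
Proof.
move=> finj oU U0; have [x [n [branch nU]]] := open_contains_cylinder oU U0.
have /choice[g gP] k : exists y : X, agree n x y /\ coord y n = f k.
  have [y [xy yk _]] := child_exists (f k) (fun m (_ : (m < n)%N) => branch m).
  by exists y.
have ginj : injective g.
  by move=> k l E; apply: finj; rewrite -(gP k).2 -(gP l).2 E.
by apply: (inj_into_card_le ginj) => k; apply: nU; exact: (gP k).1.
Qed.

(** The children of a vertex along distinct nodes span disjoint open sets, each
of which meets a dense set. *)
Lemma open_not_separable (K : Type) (f : K -> L) (U : set X) : injective f ->
  (forall k, f k \in node) -> ~ countable [set: K] ->
  open U -> U !=set0 -> ~ separable_subset U.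
Proof.
move=> finj fnode Kunc oU U0 [D Dctble Ddense].
have [x [n [branch nU]]] := open_contains_cylinder oU U0.
have nx : nodes_below n x by move=> m _; exact: branch.
have /choice[g gP] k : exists e : set_type U,
    D e /\ coord (set_val e) n = f k.
  have [y [xy yk _]] := child_exists (f k) nx.
  have oC : open (cylinder n.+1 y).
    apply: cylinder_open; apply: nodes_belowS; last by rewrite yk.
    exact: nodes_below_agree nx.
  have Uy : U y by exact: nU.
  have [||e [ye De]] := Ddense (set_val @^-1` cylinder n.+1 y).
  - by exists (SigSub (mem_set Uy)).
  - by apply: open_comp => // ? _; exact: initial_continuous.
  - by exists e; split=> //; rewrite -yk -(ye n).
apply: Kunc; apply: sub_countable Dctble.
have ginj : injective g.
  by move=> k l E; apply: finj; rewrite -(gP k).2 -(gP l).2 E.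
by apply: (inj_into_card_le ginj) => k; exact: (gP k).1.
Qed.

End Tree.

(** * Cuts of a discrete order *)

Section Cuts.
Context {d : Order.disp_t} (J : orderType d).
Implicit Types (i j : J).

Definition is_downset (D : set J) : bool :=
  `[< forall i j, i <= j -> D j -> D i >].

Record cut := Cut { cut_set : set J; _ : is_downset cut_set }.

HB.instance Definition _ := [isSub for cut_set].
HB.instance Definition _ := [Choice of cut by <:].
HB.instance Definition _ := [SubChoice_isSubPOrder of cut by <: with d].

Definition cut_mem (D : cut) (j : J) : Prop := cut_set D j.
Arguments cut_mem D j /.
Coercion cut_mem : cut >-> Funclass.

Implicit Types (D E : cut).

Lemma cut_down D i j : i <= j -> D j -> D i.
Proof. by case: D => A /= /asboolP; exact. Qed.

Lemma cut_leP D E : reflect (cut_set D `<=` cut_set E) (D <= E).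
Proof. exact: subsetPset. Qed.

Lemma cut_le_total : total (@Order.le _ cut).
Proof.
move=> D E; apply/orP; have [DE|/existsNP[j /not_implyP[Dj nEj]]] :=
  pselect (cut_set D `<=` cut_set E); first by left; apply/cut_leP.
right; apply/cut_leP => i Ei; have [ij|/ltW ji] := leP i j.
  exact: cut_down Dj.
by case: nEj; exact: cut_down Ei.
Qed.

HB.instance Definition _ := Order.POrder_isTotal.Build d cut cut_le_total.

Lemma cut_ltP D E : D < E -> exists2 j, E j & ~ D j.
Proof.
by rewrite ltNge => /cut_leP/existsNP[j /not_implyP[]]; exists j.
Qed.

Lemma lt_cut D E j : E j -> ~ D j -> D < E.
Proof. by move=> Ej nDj; rewrite ltNge; apply/cut_leP => /(_ j Ej). Qed.

Fact is_downset0 : is_downset set0. Proof. exact/asboolP. Qed.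
Fact is_downsetT : is_downset setT. Proof. exact/asboolP. Qed.

Lemma cut0_le D : Cut is_downset0 <= D.
Proof. by apply/cut_leP. Qed.

Lemma cut_leT D : D <= Cut is_downsetT.
Proof. by apply/cut_leP. Qed.

HB.instance Definition _ := Order.hasBottom.Build d cut cut0_le.
HB.instance Definition _ := Order.hasTop.Build d cut cut_leT.

Lemma cut_lub (A : set cut) : exists D, is_lub A D.
Proof.
have S : is_downset (\bigcup_(D in A) D).
  by apply/asboolP => i j ij [D AD Dj]; exists D => //; exact: cut_down Dj.
exists (Cut S); split=> [D AD|E ubE]; apply/cut_leP.
  by move=> j Dj; exists D.
by move=> j [D /ubE/cut_leP]; exact.
Qed.

Fact is_downset_below j : is_downset [set i | i <= j].
Proof. by apply/asboolP => i k ik /(le_trans ik). Qed.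

Definition principal_cut j : cut := Cut (is_downset_below j).

(** The principal cuts, together with the empty one, are the places of J between
two consecutive elements or outside all of J. *)
Definition gap : {pred cut} :=
  fun D => `[< D = \bot \/ exists j, D = principal_cut j >].

Lemma gapP D : reflect (D = \bot \/ exists j, D = principal_cut j) (D \in gap).
Proof. exact: asboolP. Qed.

Lemma principal_gap j : principal_cut j \in gap.
Proof. by apply/gapP; right; exists j. Qed.

Lemma principal_cut_le j D : D j -> principal_cut j <= D.
Proof. by move=> Dj; apply/cut_leP => i /= ij; exact: cut_down Dj. Qed.

Lemma lt_principal_cut j D : (D < principal_cut j) = ~~ `[< D j >].
Proof.
apply/idP/asboolPn => [|nDj]; last by apply: lt_cut nDj => /=.
by rewrite ltNge => + Dj; rewrite principal_cut_le.
Qed.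

Lemma principal_cut_inj : injective principal_cut.
Proof.
move=> i j E; apply/le_anti/andP; split.
  by have : cut_set (principal_cut j) i by rewrite -E /=.
by have : cut_set (principal_cut i) j by rewrite E /=.
Qed.

Lemma cut_no_max q j : q \notin gap -> q j -> exists2 i, q i & j < i.
Proof.
move=> leaf qj; apply: contrapT => nomax.
case/gapP: leaf; right; exists j; apply/le_anti.
rewrite principal_cut_le// andbT; apply/cut_leP => i qi /=.
by rewrite leNgt; apply/negP => ji; apply: nomax; exists i.
Qed.

Variables (jmin jmax : J).
Hypothesis jminP : forall j, jmin <= j.
Hypothesis jmaxP : forall j, j <= jmax.
Hypothesis jmin_max : jmin < jmax.
Hypothesis has_pred : forall j, j != jmin ->
  exists i, forall k, (k < j) = (k <= i).
Hypothesis has_succ : forall j, j != jmax ->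
  exists i, forall k, (j < k) = (i <= k).

Lemma cut_top : \top = principal_cut jmax.
Proof. by apply/le_anti; rewrite lex1 andbT; apply/cut_leP => j _; exact: jmaxP. Qed.

Lemma cut_bot_lt D : D jmin -> \bot < D.
Proof. by move=> Dj; apply: (@lt_cut _ _ jmin). Qed.

Lemma cut_jmin D : D != \bot -> D jmin.
Proof. by rewrite -lt0x => /cut_ltP[j Dj _]; exact: cut_down Dj. Qed.

(** Otherwise the least element outside q has a predecessor, which is the
greatest element of q. *)
Lemma cut_no_min q j : q \notin gap -> ~ q j -> exists2 i, ~ q i & i < j.
Proof.
move=> leaf qj; apply: contrapT => nomin.
have below i : i < j -> q i.
  by move=> ij; apply: contrapT => qi; apply: nomin; exists i.
case/gapP: leaf; have [jE|/has_pred[i iP]] := eqVneq j jmin; [left|right].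
  apply/le_anti; rewrite le0x andbT; apply/cut_leP => k qk.
  by apply: qj; rewrite jE; exact: cut_down qk.
exists i; apply/le_anti; rewrite principal_cut_le ?andbT; last by apply: below; rewrite iP.
apply/cut_leP => k qk /=; rewrite -iP ltNge; apply/negP => jk.
by apply: qj; exact: cut_down qk.
Qed.

(** A cut that is neither empty nor principal has no greatest element, and by
discreteness its complement has no least one: this makes it a limit from both
sides. *)
Lemma cut_branching_order : branching_order gap.
Proof.
split.
- exact: cut_lub.
- by apply/gapP; left.
- by rewrite cut_top principal_gap.
- exists (principal_cut jmin); first exact: principal_gap.
  rewrite cut_bot_lt//= cut_top lt_principal_cut.
  by apply/asboolPn => /=; rewrite leNgt jmin_max.
- move=> _ /gapP[->|[j ->]] N; first by rewrite eqxx in N.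
  have [jE|/has_pred[i iP]] := eqVneq j jmin.
    exists \bot; first by apply/gapP; left.
    move=> D; rewrite lt_principal_cut lex0 jE; have [->|/cut_jmin D0] := eqVneq D \bot.
      by apply/asboolPn.
    by apply/negbTE; rewrite negbK; apply/asboolP.
  exists (principal_cut i); first exact: principal_gap.
  move=> D; rewrite lt_principal_cut.
  apply/idP/cut_leP => [/asboolPn nDj k Dk /=|Di].
    by rewrite -iP ltNge; apply/negP => jk; apply: nDj; exact: cut_down Dk.
  by apply/asboolPn => Dj; have := Di _ Dj; rewrite /= -iP ltxx.
- move=> _ /gapP[->|[j ->]] N.
    exists (principal_cut jmin); first exact: principal_gap.
    move=> D; apply/idP/idP => [|/cut_leP/(_ jmin)/= /(_ (lexx _))]; last exact: cut_bot_lt.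
    by rewrite lt0x => /cut_jmin; exact: principal_cut_le.
  have [jE|/has_succ[i iP]] := eqVneq j jmax; first by rewrite jE cut_top eqxx in N.
  exists (principal_cut i); first exact: principal_gap.
  move=> D; apply/idP/idP => [/cut_ltP[k Dk /negP]|/cut_leP/(_ i)/=/(_ (lexx _)) Di].
    by rewrite -ltNge iP => ik; apply: principal_cut_le; exact: cut_down Dk.
  by apply: (@lt_cut _ _ i) => //=; apply/negP; rewrite -ltNge iP.
- move=> q D leaf /cut_ltP[j qj Dj]; have [i qi ji] := cut_no_max leaf qj.
  exists (principal_cut i); first exact: principal_gap.
  apply/andP; split; first by apply: (@lt_cut _ _ j) => //=; exact: ltW.
  have [k qk ik] := cut_no_max leaf qi.
  by apply: (@lt_cut _ _ k) => //=; apply/negP; rewrite -ltNge.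
- move=> q D leaf /cut_ltP[j Dj qj]; have [i qi ij] := cut_no_min leaf qj.
  exists (principal_cut i); first exact: principal_gap.
  apply/andP; split; first by apply: (@lt_cut _ _ i) => //=.
  by apply: (@lt_cut _ _ j) => //=; apply/negP; rewrite -ltNge.
Qed.

End Cuts.

(** * Well-orders and countable rank *)

Section WellOrder.
Variable K : Type.

Definition well_ordered : Type := {classic K}.
HB.instance Definition _ := Choice.on well_ordered.

Definition wo_le : rel well_ordered :=
  sval (well_ordering_principle {classic K}).

Lemma wo_min_uniq : well_order wo_le.
Proof. by rewrite /wo_le; case: well_ordering_principle. Qed.

Lemma wo_le_total : total wo_le.
Proof.
move=> x y; have := wo_chainW (withinW wo_min_uniq : wo_chain wo_le predT).
by move=> /(_ x y isT isT).
Qed.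

(** Antisymmetry comes from the uniqueness of the least element of a pair, and
transitivity from the existence of a least element of a triple. *)
Lemma wo_le_anti : antisymmetric wo_le.
Proof.
move=> x y /andP[xy yx].
have refl z : wo_le z z by have := wo_le_total z z; rewrite orbb.
have [|m [_ uniq]] := wo_min_uniq (A := [pred k | k \in [:: x; y]]).
  by exists x; rewrite !inE eqxx.
have <- : m = x.
  apply: uniq; split=> [|w]; rewrite !inE ?eqxx// => /orP[] /eqP -> //.
apply: uniq; split=> [|w]; rewrite !inE ?eqxx ?orbT// => /orP[] /eqP -> //.
Qed.

Lemma wo_le_trans : transitive wo_le.
Proof.
move=> y x z xy yz.
have [|m [[]]] := wo_min_uniq (A := [pred k | k \in [:: x; y; z]]).
  by exists x; rewrite !inE eqxx.
rewrite !inE => /or3P[] /eqP -> low _.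
- by apply: low; rewrite !inE eqxx !orbT.
- suff -> : x = y by [].
  by apply: wo_le_anti; rewrite xy low// !inE eqxx.
- suff <- : y = z by [].
  by apply: wo_le_anti; rewrite yz low// !inE eqxx orbT.
Qed.

HB.instance Definition _ := Order.isOrder.Build (Order.Disp tt tt) well_ordered
  (fun _ _ => erefl) (fun _ _ => erefl) (fun _ _ => erefl)
  wo_le_anti wo_le_trans wo_le_total.

Implicit Types (k w : well_ordered).

Lemma wo_least (A : set well_ordered) : A !=set0 ->
  exists2 k, A k & forall w, A w -> k <= w.
Proof.
move=> [a Aa]; have [|m [[Am low] _]] := wo_min_uniq (A := [pred k | `[< A k >]]).
  by exists a; apply/asboolP.
by exists m => [|w Aw]; [exact/asboolP|exact/low/asboolP].
Qed.

Lemma countable_initial k :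
  countable [set w | w < k] -> countable [set w | w <= k].
Proof.
move=> ck; pose F (b : bool) := if b then [set w | w < k] else [set k].
have : countable (\bigcup_(b in [set: bool]) F b).
  by apply: bigcup_countable => // -[] _ //; exact: countable1.
apply: sub_countable; apply: subset_card_le => w /=.
by rewrite le_eqVlt => /predU1P[->|wk]; [exists false|exists true].
Qed.

Definition countable_rank : set well_ordered :=
  [set k | countable [set w | w < k]].

Lemma countable_rank_down k w : w <= k -> countable_rank k -> countable_rank w.
Proof.
by move=> wk; apply: sub_countable; apply: subset_card_le => u /= /lt_le_trans; exact.
Qed.

(** Countably many elements of countable rank lie above only countably many
elements, while those of countable rank are uncountably many: were they
countable, the least element not among them would have countable rank. *)
Lemma countable_rank_unbounded : ~ countable [set: K] ->
  forall c : nat -> well_ordered, (forall n, countable_rank (c n)) ->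
  exists2 k, countable_rank k & forall n, c n < k.
Proof.
move=> Kunc c cr; apply: contrapT => nok.
have rank_countable : countable countable_rank.
  have : countable (\bigcup_n [set w | w <= c n]).
    by apply: bigcup_countable => // n _; exact/countable_initial/cr.
  apply: sub_countable; apply: subset_card_le => k kr; apply: contrapT => kc.
  apply: nok; exists k => // n; rewrite ltNge; apply/negP => kn.
  by apply: kc; exists n.
have [E|/eqP/set0P/wo_least[w wr low]] := pselect (~` countable_rank = set0).
  by apply: Kunc; rewrite -[countable_rank]setCK E setC0 in rank_countable.
apply: wr; apply: sub_countable rank_countable; apply: subset_card_le => k /= kw.
by apply: contrapT => /low; rewrite leNgt kw.
Qed.

End WellOrder.

(** * A discrete order with endpoints *)

Section Blocks.
Variable K : Type.
Hypothesis K_uncountable : ~ countable [set: K].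

Local Notation W := (well_ordered K).

Definition least (k : W) : bool := `[< forall w, k <= w >].

(** The negative half of the first block is moved to the far end: comparing this
boolean first makes (least, 0) the minimum and (least, -1) the maximum, and
leaves consecutive integers consecutive everywhere else. *)
Definition wrapped (p : W * int) : bool := least p.1 && (p.2 < 0)%R.

Definition block_key (p : W * int) : bool *l (W *l int) := (wrapped p, p).

Definition blocks : Type := (W * int)%type.
HB.instance Definition _ := Choice.on blocks.

Definition block_le : rel blocks := fun p q => block_key p <= block_key q.

Lemma block_le_anti : antisymmetric block_le.
Proof. by move=> p q /le_anti[]. Qed.

Lemma block_le_trans : transitive block_le.
Proof. by move=> q p r; exact: le_trans. Qed.

Lemma block_le_total : total block_le.
Proof. by move=> p q; exact: le_total. Qed.

HB.instance Definition _ := Order.isOrder.Build (Order.Disp tt tt) blocks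
  (fun _ _ => erefl) (fun _ _ => erefl) (fun _ _ => erefl)
  block_le_anti block_le_trans block_le_total.

Implicit Types (p q : blocks) (k w : W).

Lemma block_leE p q : (p <= q) = (wrapped p <= wrapped q) &&
  ((wrapped q <= wrapped p) ==>
    (p.1 <= q.1) && ((q.1 <= p.1) ==> (p.2 <= q.2)%R)).
Proof. by []. Qed.

Lemma block_ltE p q : (p < q) = (wrapped p <= wrapped q) &&
  ((wrapped q <= wrapped p) ==>
    (p.1 <= q.1) && ((q.1 <= p.1) ==> (p.2 < q.2)%R)).
Proof.
by rewrite lt_leAnge; exact: esym (lt_leAnge (block_key p) (block_key q)).
Qed.

Lemma least_exists : exists k : W, least k.
Proof.
have [|k _ low] := @wo_least K setT; last by exists k; apply/asboolP => w; exact: low.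
apply/set0P; apply/eqP => W0; apply: K_uncountable.
by rewrite [X in countable X](_ : _ = set0)//; exact: countable0.
Qed.

Lemma least_uniq k w : least k -> least w -> k = w.
Proof.
by move=> /asboolP kl /asboolP wl; apply/le_anti; rewrite kl wl.
Qed.

Lemma block_succ p (n : int) :
  wrapped (p.1, n + 1)%R = wrapped (p.1, n) :> bool ->
  p.2 = n -> forall q, (p < q) = (((p.1, n + 1)%R : blocks) <= q).
Proof.
case: p => k z /= E -> q; rewrite block_ltE block_leE E /=.
by rewrite lezD1.
Qed.

Lemma block_has_succ (k0 : W) p : least k0 -> p != (k0, -1)%R ->
  exists q : blocks, forall r, (p < r) = (q <= r).
Proof.
case: p => k z k0l N; exists (k, z + 1)%R; apply: block_succ => //.
rewrite /wrapped/=; have [kl/=|//] := boolP (least k).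
have zN : z != (-1)%R by apply: contra_neq N => ->; rewrite (least_uniq kl k0l).
by move: zN; lia.
Qed.

Lemma block_has_pred (k0 : W) p : least k0 -> p != (k0, 0)%R ->
  exists q : blocks, forall r, (r < p) = (r <= q).
Proof.
case: p => k z k0l N; exists (k, z - 1)%R => r.
have E : wrapped (k, z - 1)%R = wrapped (k, z).
  rewrite /wrapped/=; have [kl/=|//] := boolP (least k).
  have zN : z != 0%R by apply: contra_neq N => ->; rewrite (least_uniq kl k0l).
  by move: zN; lia.
rewrite block_ltE block_leE E /=; congr (_ && (_ ==> _ && (_ ==> _))).
by rewrite -ltzD1 GRing.subrK.
Qed.

Lemma wrapped0 k : wrapped (k, 0%R) = false.
Proof. by rewrite /wrapped/= ltxx andbF. Qed.

Lemma block_min (k0 : W) p : least k0 -> ((k0, 0)%R : blocks) <= p.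
Proof.
move=> k0l; rewrite block_leE wrapped0/=.
have /asboolP -> := k0l; rewrite /=.
apply/implyP => pw; apply/implyP => pk.
have pl : least p.1 by apply/asboolP => w; rewrite (le_trans pk)//; move: k0l => /asboolP.
by move: pw; rewrite /wrapped pl/= (leNgt 0%R); case: (p.2 < 0)%R.
Qed.

Lemma block_max (k0 : W) p : least k0 -> p <= ((k0, -1)%R : blocks).
Proof.
move=> k0l; rewrite block_leE {2 3}/wrapped/= k0l /=.
have -> : (wrapped p <= true) by case: (wrapped p).
apply/implyP; rewrite /wrapped; case: (boolP (least p.1)) => //= pl.
rewrite (least_uniq pl k0l) lexx /=; case: ltP => //; lia.
Qed.

Lemma block_min_lt_max (k0 : W) : least k0 ->
  ((k0, 0)%R : blocks) < ((k0, -1)%R : blocks).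
Proof. by move=> k0l; rewrite block_ltE wrapped0/= /wrapped/= k0l. Qed.

Lemma block_branching : branching_order (@gap _ blocks).
Proof.
have [k0 k0l] := least_exists.
apply: (@cut_branching_order _ blocks ((k0, 0)%R : blocks) ((k0, -1)%R : blocks)).
- by move=> p; exact: block_min.
- by move=> p; exact: block_max.
- exact: block_min_lt_max.
- by move=> p; exact: block_has_pred.
- by move=> p; exact: block_has_succ.
Qed.

Fact is_downset_countable_rank :
  is_downset [set p : blocks | ~~ wrapped p /\ countable_rank p.1].
Proof.
apply/asboolP => p q pq [/negbTE qw qr] /=; move: pq; rewrite block_leE qw.
case: (wrapped p) => //= /andP[pq _]; split=> //; exact: countable_rank_down pq qr.
Qed.

(** This is the leaf that no sequence approaches from below: each cut below it
misses an element in a block of countable rank, and countably many such blocks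
have a common bound of countable rank. *)
Definition rank_cut : cut blocks := Cut is_downset_countable_rank.

Lemma rank_cut_no_max p : rank_cut p -> exists2 q : blocks, rank_cut q & p < q.
Proof.
case: p => k z [/= zw kr]; exists (k, z + 1)%R.
  split=> //=; move: zw; rewrite /wrapped/=; case: (least k) => //=; lia.
by rewrite block_ltE (negbTE zw)/= lexx ltzD1 lexx /= implybT.
Qed.

Lemma rank_cut_leaf : rank_cut \notin @gap _ blocks.
Proof.
have [k0 /asboolP k0l] := least_exists.
have k0r : rank_cut ((k0, 0)%R : blocks).
  split; rewrite ?wrapped0//=.
  rewrite /countable_rank/= (_ : [set w | _] = set0); first exact: countable0.
  by apply/seteqP; split=> // w /=; rewrite ltNge k0l.
apply/gapP => -[E|[p E]]; first by rewrite E in k0r.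
have [q] : exists2 q : blocks, rank_cut q & p < q.
  by apply: rank_cut_no_max; rewrite E /=.
by rewrite E /= leNgt => /negP.
Qed.

Lemma rank_cut_cofinality (c : nat -> cut blocks) : (forall n, c n < rank_cut) ->
  exists2 b, b < rank_cut & forall n, c n < b.
Proof.
move=> cq; have /choice[p pP] n : exists p : blocks, rank_cut p /\ ~ c n p.
  by have [p ? ?] := cut_ltP (cq n); exists p.
have [k kr pk] := countable_rank_unbounded K_uncountable (fun n => (pP n).1.2).
have qk : rank_cut ((k, 0)%R : blocks) by split; rewrite ?wrapped0.
exists (principal_cut ((k, 0)%R : blocks)).
  have [q qr kq] := rank_cut_no_max qk.
  by apply: (lt_cut qr) => /=; apply/negP; rewrite -ltNge.
move=> n; apply: lt_cut (pP n).2 => /=.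
have [[/negbTE pw _] _] := pP n.
by rewrite block_leE wrapped0 pw/= ltW//= leNgt pk.
Qed.

End Blocks.

(** * Existence *)

Theorem theorem1p5 (K : Type) (K_uncountable : ~ countable [set: K]) :
  exists (d : Order.disp_t) (X : orderTopologicalType d),
    [/\ compact [set: X],
        totally_disconnected [set: X],
        (forall U : set X, open U -> U !=set0 -> [set: K] #<= U) &
        exists R : set (X * X),
          [/\ topological_tournament R,
              balanced_tournament R,
              dense [set x | cycle_point R x] /\
                Gdelta [set x | cycle_point R x],
              dense [set x : X | ~ Gdelta [set x]] &
              (forall U : set X, open U -> U !=set0 ->
                 ~ separable_subset U)]].
Proof.
have bL := block_branching K_uncountable.
pose f (k : K) : cut (blocks K) := principal_cut ((k, 0%R) : blocks K).
have finj : injective f by move=> k l /principal_cut_inj[].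
exists _, (tree_space (@gap _ (blocks K))); split.
- exact: complete_compact (tree_lub bL).
- exact: tree_totally_disconnected bL.
- by move=> U; exact: (open_card bL finj).
exists (@tree_tournament _ _ _); split.
- exact: tree_topological_tournament.
- exact: tree_balanced.
- by split; [exact: dense_cycle_points|exact: Gdelta_cycle_points].
- apply: (dense_non_Gdelta bL (rank_cut_leaf K_uncountable)).
  exact: (rank_cut_cofinality K_uncountable).
- move=> U; apply: (open_not_separable bL finj) => // k.
  exact: principal_gap.
Qed.
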